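(* Let $\alpha$ be a Pisot number of degree $d$ with minimal polynomial $P(x)=x^d-a_1x^{d-1}-a_2x^{d-2}-\dots-a_{d-1}x-a_d$, where $a_i\in\mathbb Z$. For positive integers $t$ and $j\in\{1,\dots,t\}$ put $s_{j,t}=\sum_{1\le i\le d,\ i\equiv j \pmod t} a_i$. Suppose that $\sum_{i=1}^d a_i$ is even. Then $$L(\alpha)\ge \max\Big\{ \Big\|\frac{s_{1,1}-2}{2s_{1,1}-2}\Big\|,\ \Big\|\frac{s_{1,2}-s_{2,2}}{2(s_{1,2}-s_{2,2})+2}\Big\|,\ \frac{(s_{1,4}-s_{3,4})^2-|s_{1,4}-s_{3,4}|+(s_{2,4}-s_{4,4}+1)^2-|s_{2,4}-s_{4,4}+1|}{2(s_{1,4}-s_{3,4})^2+2(s_{2,4}-s_{4,4}+1)^2}\Big\}.$$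
   Context: A Pisot number is a real algebraic integer $\alpha>1$ all of whose other conjugates lie strictly inside the unit disc. For real $x$, $\|x\|$ denotes the distance from $x$ to the nearest integer. For a Pisot number $\alpha$, $L(\alpha):=\sup_{\xi\in\mathbb R}\liminf_{n\to\infty}\|\xi\alpha^n\|$. Note $s_{4,4}$ is the sum of the $a_i$ with $i\equiv 0\pmod 4$, and $s_{1,1}=\sum_{i=1}^d a_i$. *)

(* Defs.v *)
From mathcomp Require Export all_boot all_order all_algebra.
From mathcomp Require Export all_classical all_reals all_analysis.
From mathcomp Require Export complex.

Set Implicit Arguments.
Unset Strict Implicit.
Unset Printing Implicit Defensive.

Import Order.TTheory GRing.Theory Num.Theory.
Import numFieldNormedType.Exports.

Local Open Scope classical_set_scope.
Local Open Scope ring_scope.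

(* Minimality of the degree is required only among nonzero rational
   polynomials vanishing at [x]; no monic assumption on [q] is needed. *)
Definition is_minimal_polynomial (K : numFieldType) (p : {poly rat}) (x : K) : Prop :=
  [/\ p \is monic,
      root (map_poly ratr p) x
    & forall q : {poly rat},
        q != 0 -> root (map_poly ratr q) x -> (size p <= size q)%N].

(* Conjugates of a real number are taken in the complex numbers [R[i]], and
   [x] is a conjugate of itself. *)
Definition conjugate (R : realType) (x : R) (z : R[i]) : Prop :=
  exists2 p : {poly rat},
    is_minimal_polynomial p x & root (map_poly ratr p) z.

(* For [alpha] integral over the integers a minimal polynomial always exists,
   so the condition on the conjugates is never vacuous by lack of one. The
   modulus of [z : R[i]] is itself an element of [R[i]], with zero imaginary
   part. *)
Definition pisot (R : realType) (alpha : R) : Prop :=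
  [/\ integralOver (intr : int -> R) alpha,
      1 < alpha
    & forall z : R[i], conjugate alpha z -> z != (alpha%:C)%C -> `|z| < 1].

Definition dist_int (R : realType) (x : R) : R :=
  inf (range (fun m : int => `|x - m%:~R|)).

(* Since [0 <= dist_int x <= 1/2], the real-valued [limn_inf] and [sup] are the
   genuine lower limit and least upper bound. *)
Definition pisot_L (R : realType) (alpha : R) : R :=
  sup (range (fun xi : R =>
    limn_inf (fun n : nat => dist_int (xi * alpha ^+ n)))).

(* [a i] is the coefficient a_i for [1 <= i <= d]; other values of [a] are
   never used. *)
Definition pisot_poly (d : nat) (a : nat -> int) : {poly int} :=
  'X^d - \sum_(1 <= i < d.+1) a i *: 'X^(d - i).

Definition residue_sum (d : nat) (a : nat -> int) (j t : nat) : int :=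
  \sum_(1 <= i < d.+1 | i == j %[mod t]) a i.

(* Main.v *)
(** Let [S] be the shift on sequences and [P] the minimal polynomial of [alpha].
    Suppose a periodic real sequence [e] satisfies [P(S) e] integer-valued. The
    solution [y] of [P(S) y = 0] with the same initial values as [e] differs
    from [e] by integers. Write [P = (X - alpha) Q]; all roots of [Q] lie in the
    open unit disc, so [(S - alpha) y], which is annihilated by [Q(S)], decays
    geometrically and hence [y n = xi * alpha ^ n + o(1)] for some real [xi].
    Thus [L(alpha)] is at least the minimum of [dist_int (e n)]. The three bounds
    come from [e] constant, [e n = (-1)^n x], and [e] of the form
    [x, y, -x, -y, ...] with [x, y] as close to [1/2] as integrality of [P(S) e]
    allows; evenness of the sum of the [a i] makes all the denominators
    nonzero. *)
Require Import Defs.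
From mathcomp Require Import zify ring lra.
From mathcomp Require polyorder.
Set Implicit Arguments.
Unset Strict Implicit.
Unset Printing Implicit Defensive.

Import Order.TTheory GRing.Theory Num.Theory.
Import numFieldNormedType.Exports.
Local Open Scope classical_set_scope.
Local Open Scope ring_scope.

(** * Polynomials in the shift operator acting on sequences *)

Section Shift.

Variable K : comNzRingType.

(* The action of [p] on sequences, with ['X] acting as the shift. *)
Definition shift_act (p : {poly K}) (z : nat -> K) (n : nat) : K :=
  \sum_(i < size p) p`_i * z (n + i)%N.

Lemma shift_act_widen (N : nat) (p : {poly K}) z n : (size p <= N)%N ->
  shift_act p z n = \sum_(i < N) p`_i * z (n + i)%N.
Proof.
move=> leN; rewrite /shift_act (big_ord_widen N (fun i => p`_i * z (n + i)%N) leN).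
rewrite big_mkcond; apply: eq_bigr => i _ /=; case: ltnP => // le_i.
by rewrite nth_default ?mul0r.
Qed.

(** Peeling off a linear factor turns a recurrence into one for the twisted differences, one degree
    lower. *)
Lemma shift_act_mulXsubC (c : K) (q : {poly K}) z n :
  shift_act (('X - c%:P) * q) z n
    = shift_act q (fun k => z k.+1 - c * z k) n.
Proof.
have leN : (size (('X - c%:P) * q)%R <= (size q).+1)%N.
  by apply: leq_trans (size_polyMleq _ _) _; rewrite size_XsubC.
rewrite (shift_act_widen _ _ leN) (shift_act_widen _ _ (leqnn _)).
under eq_bigr do rewrite mulrBl coefB coefCM coefXM mulrBl.
under [RHS]eq_bigr do rewrite mulrBr.
rewrite !sumrB; congr (_ - _).
  rewrite big_ord_recl /= mul0r add0r; apply: eq_bigr => i _.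
  by rewrite /= addnS.
rewrite big_ord_recr /= nth_default // mulr0 mul0r addr0.
by apply: eq_bigr => i _; rewrite -mulrA mulrCA.
Qed.

End Shift.

Lemma shift_act_map (K L : comNzRingType) (f : {rmorphism K -> L}) p z n :
  f (shift_act p z n) = shift_act (map_poly f p) (f \o z) n.
Proof.
rewrite [RHS](shift_act_widen _ _ (size_poly _ _)) rmorph_sum.
by apply: eq_bigr => i _; rewrite rmorphM coef_map.
Qed.

(** * Geometric decay when all characteristic roots lie in the open unit disc *)

Lemma contraction_decay (K : numFieldType) (r C rho : K) (z : nat -> K) :
  `|r| < 1 -> 0 < rho < 1 -> 0 <= C ->
  (forall n, `|z n.+1 - r * z n| <= C * rho ^+ n) ->
  exists C' rho' : K, [/\ 0 <= C', 0 < rho' < 1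
    & forall n, `|z n| <= C' * rho' ^+ n].
Proof.
move=> r1 /andP[rho0 rho1] C0 zP.
(* Also [s = rho + |r| * (1 - rho)], so this rate is below 1, at least [rho], and strictly above
   [|r|] even when [|r| = rho]. *)
pose s := `|r| + rho * (1 - `|r|).
have d0 : 0 < rho * (1 - `|r|) by rewrite mulr_gt0 ?subr_gt0.
have rho_s : rho <= s.
  rewrite /s mulrBr mulr1 addrCA lerDl -{1}[`|r|]mul1r -mulrBl.
  by rewrite mulr_ge0 // subr_ge0 ltW.
have s0 : 0 < s by apply: lt_le_trans rho_s.
have s1 : s < 1.
  rewrite -subr_gt0 /s [X in 0 < X](_ : _ = (1 - rho) * (1 - `|r|)); last by ring.
  by rewrite mulr_gt0 ?subr_gt0.
(* Since [D = C / (s - |r|)], one has [|r| * D + C = s * D], which closes the induction. *)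
pose D := C / (rho * (1 - `|r|)).
have D0 : 0 <= D by rewrite divr_ge0 // ltW.
exists (`|z 0| + D), s; split; rewrite ?s0 ?addr_ge0 //.
elim=> [|n IHn]; first by rewrite mulr1 lerDl.
rewrite -[z n.+1](subrK (r * z n)); apply: le_trans (ler_normD _ _) _.
rewrite normrM.
have h1 : `|z n.+1 - r * z n| <= C * s ^+ n.
  apply: le_trans (zP n) _; rewrite ler_wpM2l //.
  by apply: lerXn2r => //; rewrite nnegrE ltW.
apply: le_trans (lerD h1 (ler_wpM2l (normr_ge0 r) IHn)) _.
rewrite mulrA -mulrDl exprS mulrA ler_wpM2r ?exprn_ge0 ?(ltW s0) //.
have -> : (`|z 0| + D) * s
  = `|r| * (`|z 0| + D) + rho * (1 - `|r|) * `|z 0| + C.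
  by rewrite /s /D; field; rewrite !gt_eqF ?subr_gt0.
by rewrite [C + _]addrC lerD2r lerDl mulr_ge0 // ltW.
Qed.

(** Induction on the roots: the differences [z k.+1 - r * z k] satisfy the recurrence of the
    remaining roots, and [contraction_decay] passes their decay on to [z]. *)
Lemma recurrence_decay (K : numFieldType) (rs : seq K) (c : K) (z : nat -> K) :
  c != 0 -> (forall r, r \in rs -> `|r| < 1) ->
  (forall n, shift_act (c *: \prod_(r <- rs) ('X - r%:P)) z n = 0) ->
  exists C rho : K, [/\ 0 <= C, 0 < rho < 1
    & forall n, `|z n| <= C * rho ^+ n].
Proof.
move=> c0; elim: rs z => [|r rs IH] z rs1 zP.
  exists 0, (2^-1); split=> //.
    by rewrite invr_gt0 invf_lt1 ?ltr0n // ltr1n.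
  move=> n; rewrite mul0r normr_le0; move: (zP n).
  rewrite big_nil alg_polyC /shift_act size_polyC c0 big_ord1 polyseqC c0 /=.
  by rewrite addn0 => /eqP; rewrite mulf_eq0 (negPf c0).
have [|n|C [rho [C0 rho01 wP]]] := IH (fun k => z k.+1 - r * z k).
- by move=> s s_rs; apply: rs1; rewrite inE s_rs orbT.
- by rewrite -shift_act_mulXsubC -[RHS](zP n) big_cons scalerAr.
by apply: contraction_decay rho01 C0 wP; apply: rs1; rewrite inE eqxx.
Qed.

Section Real.
Variable R : realType.
Implicit Types (x T C rho alpha : R).

Lemma real_recurrence_decay (q : {poly R}) (z : nat -> R) : q != 0 ->
  (forall r : R[i], root (map_poly (real_complex R) q) r -> `|r| < 1) ->
  (forall n, shift_act q z n = 0) ->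
  exists C rho, [/\ 0 <= C, 0 < rho < 1 & forall n, `|z n| <= C * rho ^+ n].
Proof.
move=> q0 rq zP; pose qC := map_poly (real_complex R) q.
have [rs qE] := closed_field_poly_normal qC.
have qC0 : lead_coef qC != 0 by rewrite lead_coef_eq0 map_poly_eq0.
have rsP r : r \in rs -> `|r| < 1.
  by move=> r_rs; apply: rq; rewrite -/qC qE rootZ // root_prod_XsubC.
have [|C [rho [C0 rho01 zb]]] :=
  recurrence_decay (z := fun n => real_complex R (z n)) qC0 rsP.
  by move=> n; rewrite -qE -(shift_act_map (real_complex R)) zP rmorph0.
(* The order of [R[i]] compares only numbers with equal imaginary parts, so [C] and [rho] are
   real. *)
case: C C0 zb => Cr Ci; case: rho rho01 => rr ri.
rewrite !lecE !ltcE /= => /andP[/andP[/eqP -> r0] /andP[_ r1]].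
move=> /andP[/eqP -> C0] zb; exists Cr, rr; split; rewrite ?r0 //.
move=> n; move: (zb n); rewrite -/(real_complex R rr) -/(real_complex R Cr).
by rewrite normc_def /= expr0n addr0 sqrtr_sqr -rmorphXn -rmorphM lecR.
Qed.

(* The intervals of radius [K * rho ^+ n / alpha ^+ n] around
   [y n / alpha ^+ n], with [K := C / (alpha - rho)], are nested. *)
Lemma expanding_approx alpha C rho (y : nat -> R) :
  1 < alpha -> 0 < rho < 1 ->
  (forall n, `|y n.+1 - alpha * y n| <= C * rho ^+ n) ->
  exists c, forall n, `|c * alpha ^+ n - y n| <= C / (alpha - rho) * rho ^+ n.
Proof.
move=> a1 /andP[rho0 rho1] yP; pose K := C / (alpha - rho).
have a0 n : 0 < alpha ^+ n by rewrite exprn_gt0 // (lt_trans ltr01).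
have CE : C = K * (alpha - rho) by rewrite /K divfK // gt_eqF // subr_gt0 (lt_trans rho1).
pose L n := (y n - K * rho ^+ n) / alpha ^+ n.
pose U n := (y n + K * rho ^+ n) / alpha ^+ n.
have K0 : 0 <= K.
  rewrite /K divr_ge0 //; first by move: (yP 0); rewrite mulr1; apply: le_trans.
  by rewrite subr_ge0 ltW // (lt_trans rho1).
(* With denominators cleared and [C = K * (alpha - rho)], this is the lower half of [yP n]; [US] is
   the upper half. *)
have LS n : L n <= L n.+1.
  rewrite /L ler_pdivrMr // [leRHS]mulrAC ler_pdivlMr // (exprS alpha) mulrA ler_pM2r //.
  move: (yP n); rewrite ler_norml => /andP[yn _]; move: yn; rewrite CE exprS.
  by move=> yn; lra.
have US n : U n.+1 <= U n.
  rewrite /U ler_pdivrMr // [leRHS]mulrAC ler_pdivlMr // (exprS alpha) mulrA ler_pM2r //.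
  move: (yP n); rewrite ler_norml => /andP[_ yn]; move: yn; rewrite CE exprS.
  by move=> yn; lra.
have LU n m : L n <= U m.
  have /nondecreasing_seqP/(_ _ _ (leq_maxl n m)) := LS.
  move=> /le_trans; apply.
  have /nonincreasing_seqP/(_ _ _ (leq_maxr n m)) := US.
  apply: le_trans; rewrite /L /U ler_pM2r ?invr_gt0 // lerD2l.
  by rewrite ge0_cp // mulr_ge0 // exprn_ge0 // ltW.
have hL : has_sup (range L).
  by split; [exists (L 0); exists 0 | exists (U 0) => _ [n _ <-]].
exists (sup (range L)) => n; rewrite -/K ler_norml; apply/andP; split.
  have : L n <= sup (range L) by apply: ub_le_sup; [case: hL | exists n].
  by rewrite /L ler_pdivrMr //; move=> ?; lra.
have : sup (range L) <= U n by apply: ge_sup => [|_ [m _ <-]] //; case: hL.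
by rewrite /U ler_pdivlMr //; move=> ?; lra.
Qed.

(** * Distance to the nearest integer and lower bounds for [pisot_L] *)

Lemma le_dist_int T x :
  (forall m : int, T <= `|x - m%:~R|) <-> T <= dist_int x.
Proof.
split=> [Tx|Tx m]; first by apply: lb_le_inf => [|_ [m _ <-]//]; exists `|x - 0|; exists 0.
apply: le_trans Tx _; apply: ge_inf; last by exists m.
by exists 0 => _ [k _ <-].
Qed.

Lemma dist_int_ge0 x : 0 <= dist_int x.
Proof. by apply/le_dist_int. Qed.

Lemma dist_int_le1 x : dist_int x <= 1.
Proof.
have /le_dist_int/(_ (Num.floor x)) := lexx (dist_int x).
move/le_trans; apply; have := floor_itv x.
by rewrite intrD => /andP[? ?]; rewrite ger0_norm ?subr_ge0 //; lra.
Qed.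

Lemma dist_intN x : dist_int (- x) = dist_int x.
Proof.
suff le (y : R) : dist_int y <= dist_int (- y).
  by apply/le_anti; rewrite -{2}(opprK x) !le.
apply/le_dist_int => m; rewrite -opprD normrN.
by have /le_dist_int/(_ (- m)) := lexx (dist_int y); rewrite intrN opprK.
Qed.

Lemma bounded_fun_unit_interval (u : nat -> R) :
  (forall n, 0 <= u n <= 1) -> bounded_fun u.
Proof.
move=> u01; exists 1; split=> // M M1 n _ /=.
by have /andP[u0 u1] := u01 n; rewrite ger0_norm // (le_trans u1) ?ltW.
Qed.

Lemma pisot_L_ge alpha T xi (rho C : R) (e : nat -> R) : 0 < rho < 1 ->
  (forall n, T <= dist_int (e n)) ->
  (forall n, exists m : int, `|xi * alpha ^+ n - (e n + m%:~R)| <= C * rho ^+ n) ->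
  T <= pisot_L alpha.
Proof.
move=> /andP[rho0 rho1] Te eP.
pose f x := limn_inf (fun n : nat => dist_int (x * alpha ^+ n)).
have bf x : bounded_fun (fun n : nat => dist_int (x * alpha ^+ n)).
  by apply: bounded_fun_unit_interval => n; rewrite dist_int_ge0 dist_int_le1.
have lbx x n : lbound (sdrop (fun n : nat => dist_int (x * alpha ^+ n)) n) 0.
  by move=> _ [k _ <-]; apply: dist_int_ge0.
have le1 x n : infs (fun n : nat => dist_int (x * alpha ^+ n)) n <= 1.
  apply: le_trans (ge_inf _ _) (dist_int_le1 (x * alpha ^+ n)).
    by exists 0.
  by exists n => /=.
have ubf : has_ubound (range f).
  exists 1 => _ [x _ <-]; rewrite /f limn_infE //; apply: ge_sup.
    by exists (infs (fun n => dist_int (x * alpha ^+ n)) 0); exists 0.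
  by move=> _ [n _ <-].
apply: (le_trans _ (ub_le_sup ubf (_ : range f (f xi)))); last by exists xi.
(* The lower limit is the supremum of the infima of tails. Once the error [C * rho ^+ n] stays below
   [d], the infimum of that tail is at least [T - d]. *)
rewrite /f limn_infE //; apply/ler_addgt0Pl => d d0.
have := @cvg_geometric R C rho; rewrite ger0_norm ?(ltW rho0) // => /(_ rho1).
move=> /cvgrPdist_lt/(_ _ d0)[N _ NP]; rewrite -lerBlDl.
have ubi : has_ubound (range (infs (fun n => dist_int (xi * alpha ^+ n)))).
  by exists 1 => _ [n _ <-].
apply: (le_trans _ (ub_le_sup ubi (_ : range _ (infs (fun n => dist_int (xi * alpha ^+ n)) N)))); last by exists N.
apply: lb_le_inf; first by exists (dist_int (xi * alpha ^+ N)); exists N => /=.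
move=> _ [n /= Nn <-]; apply/le_dist_int => k.
(* The integer [m] is absorbed by comparing [e n] with [k - m] instead of [k]. *)
have [m mP] := eP n; have /le_dist_int/(_ (k - m)) := Te n.
have := NP n Nn; rewrite sub0r normrN /geometric /= => /(le_lt_trans (ler_norm _)) lt_d.
rewrite intrB => Tk; rewrite lerBlDr (le_trans Tk) //.
have -> : e n - (k%:~R - m%:~R) = (xi * alpha ^+ n - k%:~R) - (xi * alpha ^+ n - (e n + m%:~R)) by ring.
by rewrite (le_trans (ler_normB _ _)) // lerD2l (le_trans mP) // ltW.
Qed.

End Real.

(** * Solving recurrences, and the shift form of the given polynomial *)

Lemma causal_fixpoint (V : Type) (v0 : V) (G : (nat -> V) -> nat -> V) :
  (forall f g n, (forall k, (k < n)%N -> f k = g k) -> G f n = G g n) ->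
  exists y, forall n, y n = G y n.
Proof.
move=> Gc; pose h k := iter k G (fun=> v0).
(* The value at [n] stabilises after [n.+1] iterations, so the diagonal is a fixed point. *)
have hE n : forall k, (n < k)%N -> h k n = h n.+1 n.
  have [m] := ubnP n; elim: m n => // m IH n lt_nm [//|k] le_nk.
  apply: Gc => j lt_jn; have lt_jm := leq_trans lt_jn lt_nm.
  by apply: etrans (IH j lt_jm k (leq_trans lt_jn le_nk)) (esym (IH j lt_jm n lt_jn)).
exists (fun n => h n.+1 n) => n; apply: Gc => j lt_jn.
exact: hE.
Qed.

Lemma sum_mul_delta (K : pzSemiRingType) (c : K) (f : nat -> K) k N :
  (k < N)%N -> \sum_(j < N) c * (nat_of_ord j == k)%:R * f j = c * f k.
Proof.
move=> lt_kN; rewrite (bigD1 (Ordinal lt_kN)) //= eqxx mulr1 big1 ?addr0 //.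
by move=> j /negPf jk; rewrite -val_eqE /= in jk; rewrite jk mulr0 mul0r.
Qed.

Lemma shift_act_pisot_poly (K : comNzRingType) d (a : nat -> int) (z : nat -> K) n :
  shift_act (map_poly intr (pisot_poly d a)) z n
    = z (n + d)%N - \sum_(1 <= i < d.+1) (a i)%:~R * z (n + d - i)%N.
Proof.
set p := map_poly _ _; pose N := maxn (size p) d.+1.
(* Summing up to [N] brings every exponent up to [d] into range without computing [size p]. *)
rewrite (shift_act_widen z n (leq_maxl (size p) d.+1)) -/N.
have lt_dN : (d < N)%N by rewrite leq_maxr.
under eq_bigr => j _.
  rewrite coef_map /= coefB coefXn coef_sum rmorphB rmorph_sum mulrBl /=.
  rewrite mulr_suml.
  over.
rewrite sumrB exchange_big /=; congr (_ - _).
  rewrite -[RHS]mul1r -(sum_mul_delta 1 (fun j => z (n + j)%N) lt_dN).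
  by apply: eq_bigr => j _; rewrite mul1r rmorph_nat.
apply: eq_big_nat => i /andP[i0 le_id].
rewrite -addnBA // -(sum_mul_delta _ (fun j => z (n + j)%N) (k := (d - i)%N) (N := N)).
  by apply: eq_bigr => j _; rewrite coefZ coefXn rmorphM rmorph_nat.
by apply: leq_ltn_trans (leq_subr _ _) lt_dN.
Qed.

(** * The minimal polynomial of a Pisot number and its cofactor *)

Section MinimalPolynomial.
Variables (R : realType) (alpha : R) (p : {poly rat}).
Hypothesis (pmin : is_minimal_polynomial p alpha).

(** In characteristic 0 the derivative is a nonzero rational polynomial of smaller degree, so
    minimality forbids it to vanish at [alpha]. *)
Lemma minimal_polynomial_simple : ~~ root (map_poly ratr p)^`() alpha.
Proof.
have [p_monic p_root p_le] := pmin.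
have p0 : p != 0 by rewrite monic_neq0.
have sp : (1 < size p)%N.
  rewrite -(size_map_poly (ratr : rat -> R)).
  by apply: root_size_gt1 p_root; rewrite map_poly_eq0.
apply/negP; rewrite deriv_map => /p_le le; move: (lt_size_deriv p0).
by rewrite ltnNge le // -size_poly_eq0 polyorder.size_deriv -lt0n -subn1 subn_gt0.
Qed.

Lemma pisot_minimal_cofactor : pisot alpha ->
  exists q : {poly R}, [/\ q != 0, map_poly ratr p = ('X - alpha%:P) * q
    & forall r : R[i], root (map_poly (real_complex R) q) r -> `|r| < 1].
Proof.
move=> [_ _ conj_lt1]; have [p_monic p_root _] := pmin.
have [q pE] := factor_theorem _ _ p_root; rewrite mulrC in pE.
have p0 : map_poly (ratr : rat -> R) p != 0 by rewrite map_poly_eq0 monic_neq0.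
have q0 : q != 0 by apply: contraNneq p0 => q0; rewrite pE q0 mulr0.
exists q; split=> // r qr; apply: conj_lt1.
  exists p => //.
  have -> : map_poly (ratr : rat -> R[i]) p
      = map_poly (real_complex R) (map_poly (ratr : rat -> R) p).
    rewrite -map_poly_comp; apply: eq_map_poly => x /=.
    by rewrite fmorph_rat.
  by rewrite pE rmorphM rootM qr orbT.
(* If [alpha] were a root of [q], the derivative [q + (X - alpha) * q'] would vanish there. *)
apply: contraNneq minimal_polynomial_simple => rE.
move: qr; rewrite rE fmorph_root => qa.
rewrite pE derivM derivXsubC mul1r /root hornerD hornerM hornerXsubC subrr.
by rewrite mul0r addr0.
Qed.

End MinimalPolynomial.

(* If [e] solves the recurrence modulo 1, the exact solution [y] with the same
   initial values differs from [e] by integers, and [y] is asymptotic to some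
   [xi * alpha ^+ n]. *)
Lemma pisot_L_ge_recurrence (R : realType) (alpha T : R) d (a : nat -> int)
    (e : nat -> R) :
  pisot alpha ->
  is_minimal_polynomial (map_poly (intr : int -> rat) (pisot_poly d a)) alpha ->
  (forall n, T <= dist_int (e n)) ->
  (forall n, e (n + d)%N - \sum_(1 <= i < d.+1) (a i)%:~R * e (n + d - i)%N
    \is a Num.int) ->
  T <= pisot_L alpha.
Proof.
move=> alphaP pmin Te eP.
have [|y yE] := @causal_fixpoint R 0 (fun y n => if (n < d)%N then e n
    else \sum_(1 <= i < d.+1) (a i)%:~R * y (n - i)%N).
  move=> f g n fg; case: ltnP => // le_dn; apply: eq_big_nat => i /andP[i0 le_id].
  rewrite fg // ltn_subrL i0 /=.
  by apply: leq_trans i0 _; apply: leq_trans le_dn; rewrite -ltnS.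
have ye n : y n - e n \is a Num.int.
  have [m] := ubnP n; elim: m n => // m IH n; rewrite ltnS => le_nm.
  rewrite yE; case: ltnP => [_|le_dn]; first by rewrite subrr.
  have := eP (n - d)%N; rewrite subnK // => en.
  (* Up to the integer defect of [e] in the recurrence, [y n - e n] is an integer combination of
     earlier differences. *)
  rewrite -[_ - e n](addrK (e n - \sum_(1 <= i < d.+1) (a i)%:~R * e (n - i)%N)).
  rewrite rpredB // addrA subrK -sumrB big_nat rpred_sum // => i /andP[i0 le_id].
  rewrite -mulrBr rpredM // ?intr_int // IH //.
  apply: leq_trans le_nm; rewrite ltn_subrL i0 /=.
  by apply: leq_trans i0 _; apply: leq_trans le_dn; rewrite -ltnS.
have [q [q0 pE qr]] := pisot_minimal_cofactor pmin alphaP.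
have [n|C [rho [_ rho01 zP]]] :=
  real_recurrence_decay (z := fun n => y n.+1 - alpha * y n) q0 qr.
  rewrite -shift_act_mulXsubC -pE -map_poly_comp.
  rewrite (eq_map_poly (g := intr)); last by move=> k /=; rewrite ratr_int.
  rewrite shift_act_pisot_poly [y (n + d)%N]yE ltnNge leq_addl /=.
  by rewrite subrr.
have [_ alpha1 _] := alphaP.
have [xi xiP] := expanding_approx alpha1 rho01 zP.
apply: (pisot_L_ge (xi := xi) rho01 Te) => n.
have /intrP[m mE] := ye n; exists m.
by rewrite -mE [e n + _]addrC subrK.
Qed.

(** * Periodic sequences and residue sums *)

Lemma sum_periodic (K : pzRingType) (t n d : nat) (a : nat -> int) (e : nat -> K) :
  (0 < t)%N -> (forall m, e (m + t)%N = e m) ->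
  \sum_(1 <= i < d.+1) (a i)%:~R * e (n + d - i)%N
    = \sum_(j < t) (residue_sum d a j.+1 t)%:~R * e (n + d + t - j.+1)%N.
Proof.
move=> t0 et.
have ek k m : e (m + k * t)%N = e m.
  by elim: k => [|k IH]; rewrite ?addn0 // mulSn addnCA addnC et.
under [RHS]eq_bigr do rewrite /residue_sum rmorph_sum big_mkcond mulr_suml /=.
rewrite exchange_big /=; apply: eq_big_nat => i /andP[i0 le_id].
(* Residues are represented in [1..t], hence the shift by one around the division. *)
have iE : (i = i.-1 %/ t * t + (i.-1 %% t).+1)%N.
  by rewrite addnS -divn_eq prednK.
rewrite (bigD1 (Ordinal (ltn_pmod i.-1 t0))) //= big1 ?addr0.
  have -> : i == (i.-1 %% t).+1 %[mod t] by rewrite {1}iE modnMDl.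
  have -> : (n + d + t - (i.-1 %% t).+1
    = n + d - i + (i.-1 %/ t).+1 * t)%N by rewrite mulSn; lia.
  by rewrite ek.
move=> j; have [ij|_ _] := eqVneq (i %% t)%N (j.+1 %% t)%N; last by rewrite mul0r.
case/eqP; apply: val_inj => /=; rewrite -{1}(modn_small (ltn_ord j)).
by apply/eqP; rewrite -(eqn_modDr 1) !addn1 prednK // ij.
Qed.

Lemma sum_residue_sum (t d : nat) (a : nat -> int) : (0 < t)%N ->
  \sum_(1 <= i < d.+1) a i = \sum_(j < t) residue_sum d a j.+1 t.
Proof.
move=> t0; have := @sum_periodic int t 0 d a (fun=> 1) t0 (fun=> erefl).
under eq_bigr do rewrite mulr1 intz.
by under [in RHS]eq_bigr do rewrite mulr1 intz.
Qed.

Lemma pisot_L_ge_periodic (R : realType) (alpha T : R) (d t : nat)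
    (a : nat -> int) (e : nat -> R) :
  pisot alpha ->
  is_minimal_polynomial (map_poly (intr : int -> rat) (pisot_poly d a)) alpha ->
  (0 < t)%N -> (forall n, e (n + t)%N = e n) ->
  (forall n, T <= dist_int (e n)) ->
  (forall n, e n - \sum_(j < t) (residue_sum d a j.+1 t)%:~R * e (n + t - j.+1)%N
    \is a Num.int) ->
  T <= pisot_L alpha.
Proof.
move=> alphaP pmin t0 et Te eP; apply: pisot_L_ge_recurrence alphaP pmin Te _ => n.
by rewrite (sum_periodic _ _ _ t0 et).
Qed.

Lemma dist_int_ge_near_half (R : realType) (T x : R) :
  T <= x <= 1 - T -> T <= dist_int x.
Proof.
move=> /andP[Tx xT]; apply/le_dist_int => m; case: (lerP m 0) => m0.
  have {}m0 : m%:~R <= 0 :> R by rewrite lerz0.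
  by apply: le_trans (ler_norm _); lra.
have {}m0 : 1 <= m%:~R :> R by rewrite -[1]/(1%:~R) ler_int.
by rewrite distrC; apply: le_trans (ler_norm _); lra.
Qed.

(** * The three lower bounds *)

Section Bounds.
Variables (R : realType) (alpha : R) (d : nat) (a : nat -> int).
Hypothesis (halpha : pisot alpha).
Hypothesis
  (hmin : is_minimal_polynomial (map_poly (intr : int -> rat) (pisot_poly d a)) alpha).
Hypothesis (heven : (2 %| \sum_(1 <= i < d.+1) a i)%Z).
Let s (j t : nat) : R := (residue_sum d a j t)%:~R.

(** A constant [x] must make [(1 - s 1 1) * x] an integer. As [s 1 1 - 1] is odd, [1/2] is excluded,
    and [x = 1/2 - 1 / (2 * (s 1 1 - 1))] is a nearest choice. *)
Lemma pisot_L_ge_constant : dist_int ((s 1 1 - 2) / (2 * s 1 1 - 2)) <= pisot_L alpha.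
Proof.
move: heven; rewrite (sum_residue_sum _ _ (ltnSn 0)) big_ord1 => /dvdzP[k kE].
set x := _ / _; apply: (pisot_L_ge_periodic (e := fun=> x) halpha hmin (ltn0Sn 0)) => // n.
have k0 : 2 * k%:~R - 1 != 0 :> R.
  rewrite -[2]/(2%:~R) -[1]/(1%:~R) -intrM -intrB intr_eq0; lia.
rewrite big_ord1 /x /s kE intrM.
have -> : (k%:~R * 2 - 2) / (2 * (k%:~R * 2) - 2) = (k%:~R - 1) / (2 * k%:~R - 1) :> R.
  by field; rewrite k0 /=; apply: contraNneq k0 => ?; apply/eqP; lra.
rewrite (_ : _ - _ = (1 - k)%:~R) ?intr_int // intrB.
by field.
Qed.

Lemma pisot_L_ge_alternating :
  dist_int ((s 1 2 - s 2 2) / (2 * (s 1 2 - s 2 2) + 2)) <= pisot_L alpha.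
Proof.
move: heven; rewrite (sum_residue_sum _ _ (ltn0Sn 1)) !big_ord_recl big_ord0 addr0.
move=> /dvdzP[k kE]; set x := _ / _.
apply: (pisot_L_ge_periodic (e := fun n => (-1) ^+ n * x) halpha hmin (ltn0Sn 1)) => // n.
- by rewrite exprD sqrrN expr1n mulr1.
- by rewrite -signr_odd; case: odd; rewrite ?mulN1r ?mul1r ?dist_intN.
(* [s 1 2 - s 2 2] has the parity of the full sum, and [l] is its half; thus [2 * l + 1] is odd and
   nonzero. *)
pose l := k - residue_sum d a 2 2.
have uE : s 1 2 - s 2 2 = 2 * l%:~R.
  rewrite -intrB /l; have -> : residue_sum d a 1 2 = k * 2 - residue_sum d a 2 2.
    by rewrite -kE addrK.
  by rewrite !intrB intrM; ring.
have l0 : 2 * l%:~R + 1 != 0 :> R.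
  rewrite -[2]/(2%:~R) -[1]/(1%:~R) -intrM -intrD intr_eq0; lia.
rewrite !big_ord_recl big_ord0 addr0 /= /bump !leq0n !addnS !addn0 !subSS !subn0.
rewrite (_ : _ - _ = (-1) ^+ n * (x * (1 + (s 1 2 - s 2 2)))); last first.
  by rewrite exprS /s /=; ring.
have -> : x * (1 + (s 1 2 - s 2 2)) = l%:~R.
  by rewrite /x uE; field; rewrite ?l0 /=; apply: contraNneq l0 => ?; apply/eqP; lra.
by rewrite rpredMsign intr_int.
Qed.

(** When [e n.+2 = - e n], integrality reads [B * e n + A * e n.+1], with [A = s 1 4 - s 3 4] and
    [B = s 2 4 - s 4 4 + 1]. *)
Lemma pisot_L_ge_quarter :
  ((s 1 4 - s 3 4) ^+ 2 - `|s 1 4 - s 3 4|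
        + (s 2 4 - s 4 4 + 1) ^+ 2 - `|s 2 4 - s 4 4 + 1|)
      / (2 * (s 1 4 - s 3 4) ^+ 2 + 2 * (s 2 4 - s 4 4 + 1) ^+ 2) <= pisot_L alpha.
Proof.
move: heven; rewrite (sum_residue_sum _ _ (ltn0Sn 3)) !big_ord_recl big_ord0 addr0.
move=> /dvdzP[k kE].
(* [A] and [B] have opposite parity, so [p] and [q] are integers nearest to
   [(A + B) / 2] and [(B - A) / 2]. *)
pose p := k - residue_sum d a 3 4 - residue_sum d a 4 4 + 1.
pose q := p - (residue_sum d a 1 4 - residue_sum d a 3 4).
pose A : R := s 1 4 - s 3 4; pose B : R := s 2 4 - s 4 4 + 1.
have pE : A + B + 1 = 2 * p%:~R.
  rewrite /A /B /s /p; have -> : residue_sum d a 1 4 = k * 2 - residue_sum d a 2 4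
      - residue_sum d a 3 4 - residue_sum d a 4 4 by rewrite -kE /=; ring.
  by rewrite !(intrB, intrD, intrM); ring.
have qE : B - A + 1 = 2 * q%:~R.
  by rewrite /q !intrB mulrBr -pE /A /s; ring.
rewrite -/A -/B; set T := _ / _.
(* If [A] and [B] both vanished, [pE] would make 1 even. *)
have N0 : 0 < A ^+ 2 + B ^+ 2.
  rewrite lt0r addr_ge0 ?sqr_ge0 // andbT paddr_eq0 ?sqr_ge0 // !sqrf_eq0.
  apply/negP => /andP[/eqP A0 /eqP B0]; move: pE; rewrite A0 B0 !add0r.
  rewrite -[2]/(2%:~R) -[1]/(1%:~R) -intrM => /intr_inj; lia.
(* [x] and [y] solve [B * x + A * y = p], [B * y - A * x = q], of determinant [N = A ^+ 2 + B ^+ 2].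
   They deviate from [1/2] by [(B - A) / (2 * N)] and [(B + A) / (2 * N)], while
   [T = 1/2 - (|A| + |B|) / (2 * N)]. *)
pose x := (A ^+ 2 + B ^+ 2 + B - A) / (2 * (A ^+ 2 + B ^+ 2)).
pose y := (A ^+ 2 + B ^+ 2 + B + A) / (2 * (A ^+ 2 + B ^+ 2)).
have A1 := ler_norm A; have A2 := ler_norm (- A); rewrite normrN in A2.
have B1 := ler_norm B; have B2 := ler_norm (- B); rewrite normrN in B2.
have TE : 1 - T = (A ^+ 2 + B ^+ 2 + `|A| + `|B|) / (2 * (A ^+ 2 + B ^+ 2)).
  by rewrite /T; field; rewrite -mulrDr mulf_neq0 // gt_eqF.
have Tx : T <= dist_int x.
  apply: dist_int_ge_near_half; rewrite TE /T /x -mulrDr.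
  by rewrite !ler_pM2r ?invr_gt0 ?mulr_gt0 //; apply/andP; split; lra.
have Ty : T <= dist_int y.
  apply: dist_int_ge_near_half; rewrite TE /T /y -mulrDr.
  by rewrite !ler_pM2r ?invr_gt0 ?mulr_gt0 //; apply/andP; split; lra.
have pxy : B * x + A * y = p%:~R.
  have -> : p%:~R = (A + B + 1) / 2 :> R by rewrite pE mulrC mulKf.
  by rewrite /x /y; field; rewrite gt_eqF.
have qxy : B * y - A * x = q%:~R.
  have -> : q%:~R = (B - A + 1) / 2 :> R by rewrite qE mulrC mulKf.
  by rewrite /x /y; field; rewrite gt_eqF.
pose e n := (-1) ^+ n./2 * (if odd n then y else x).
have e2 n : e n.+2 = - e n by rewrite /e /= negbK exprS mulN1r mulNr.
apply: (pisot_L_ge_periodic (e := e) halpha hmin (ltn0Sn 3)) => // n.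
- by rewrite !addnS addn0 !e2 opprK.
- by rewrite /e -signr_odd; do 2 case: odd; rewrite ?mulN1r ?mul1r ?dist_intN.
rewrite !big_ord_recl big_ord0 addr0 /= /bump !leq0n !add1n !addnS !addn0 !subSS !subn0 !e2.
rewrite (_ : _ - _ = B * e n + A * e n.+1); last first.
  by rewrite /A /B /s /=; ring.
(* For odd [n] the step to [n.+1] enters the next half-period and flips the sign, which yields the
   second equation. *)
rewrite /e /= uphalf_half; case: (odd n) => /=.
  rewrite exprS (_ : _ + _ = (-1) ^+ n./2 * (B * y - A * x)); last by ring.
  by rewrite qxy rpredMsign intr_int.
by rewrite add0n mulrCA [A * _]mulrCA -mulrDr pxy rpredMsign intr_int.
Qed.

End Bounds.

Theorem theorem2 (R : realType) (alpha : R) (d : nat) (a : nat -> int)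
  (halpha : pisot alpha)
  (hmin : is_minimal_polynomial (map_poly (intr : int -> rat) (pisot_poly d a)) alpha)
  (heven : (2 %| \sum_(1 <= i < d.+1) a i)%Z) :
  let s (j t : nat) : R := (residue_sum d a j t)%:~R in
  Num.max
    (Num.max
      (dist_int ((s 1%N 1%N - 2) / (2 * s 1%N 1%N - 2)))
      (dist_int ((s 1%N 2%N - s 2%N 2%N) / (2 * (s 1%N 2%N - s 2%N 2%N) + 2))))
    (((s 1%N 4%N - s 3%N 4%N) ^+ 2 - `|s 1%N 4%N - s 3%N 4%N|
        + (s 2%N 4%N - s 4%N 4%N + 1) ^+ 2 - `|s 2%N 4%N - s 4%N 4%N + 1|)
      / (2 * (s 1%N 4%N - s 3%N 4%N) ^+ 2 + 2 * (s 2%N 4%N - s 4%N 4%N + 1) ^+ 2))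
  <= pisot_L alpha.
Proof.
cbv zeta; rewrite !ge_max; apply/andP; split; last exact: pisot_L_ge_quarter.
by apply/andP; split; [exact: pisot_L_ge_constant | exact: pisot_L_ge_alternating].
Qed.
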